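(* Let $a,b,c,d$ be positive reals, let $h$ be an S-function, and let $H(x)=\frac{h(x)}{x}$ (with $H(0)=h'(0)$). Let $\varepsilon>0$ be a real number compatible with $c,d$, such that $H(x)>0$ and $H''(x)\le 0$ for all $x\in[0,\varepsilon]$. Then there exists a positive constant $C$ (depending on $a,b,c,d,\varepsilon,h$ but not on $n$) such that, as $n\to\infty$, $$D_n(a,b,c,d,\varepsilon;h)=\prod_{j=0}^{m(n)}\frac{h\left((cj+a)\frac{d}{n}\right)}{h\left((cj+b)\frac{d}{n}\right)}\ \sim\ C\,n^{\frac{a-b}{c}}.$$
   Context: An S-function is a real function $h$, analytic around $0$, such that $h(0)=h''(0)=0$, $h'(0)>0$, and $h''(x)\le 0$ for all positive $x$ sufficiently close to $0$. The function $h$ is understood to be defined on $[0,\varepsilon]$, and $H$ to be twice differentiable there (with $H(0)=h'(0)$ the continuous extension at $0$). Compatibility of $\varepsilon$ with $c,d$ means: $\varepsilon\le cd$, and if $\varepsilon=cd$ then $cd>1$. For $n\in\mathbb{N}$, $m=m(n)\in\mathbb{N}$ is the maximum integer such that both $(cm+a)\frac dn\le\varepsilon$ and $(cm+b)\frac dn\le\varepsilon$, that is, $m(n)=\left\lfloor \frac{n\varepsilon}{cd}-\frac{\max(a,b)}{c}\right\rfloor$ (this is a nonnegative integer for all sufficiently large $n$). The parameters $a,b,c,d,\varepsilon$ are fixed while $n\to\infty$, and $f(n)\sim g(n)$ means $f(n)/g(n)\to1$. *)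

(* Defs.v *)
From Stdlib Require Import Reals ZArith Lra Lia.
From Coquelicot Require Import Coquelicot.
Open Scope R_scope.

Definition analytic_at_0 (h : R -> R) : Prop :=
  exists (u : nat -> R) (r : R), 0 < r /\
    forall x : R, Rabs x < r -> is_pseries u x (h x).

(* Analyticity makes the total operators [Derive] and [Derive_n] below genuine
   derivatives on a neighbourhood of 0. *)
Definition S_function (h : R -> R) : Prop :=
  analytic_at_0 h /\
  h 0 = 0 /\ Derive_n h 2 0 = 0 /\ 0 < Derive h 0 /\
  at_right 0 (fun x => Derive_n h 2 x <= 0).

Definition H_of (h : R -> R) (x : R) : R :=
  if Req_EM_T x 0 then Derive h 0 else h x / x.

Definition compatible (c d eps : R) : Prop :=
  eps <= c * d /\ (eps = c * d -> 1 < c * d).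

Definition segment (a b : R) (x : R) : Prop := a <= x <= b.

(* [H1] and [H2] are the first and second derivatives of [f] on [D], relative
   to [D]; at an endpoint of a segment these are one-sided derivatives, so
   values of [f] outside [D] play no role. *)
Definition twice_derivative_on (D : R -> Prop) (f H1 H2 : R -> R) : Prop :=
  forall x : R, D x -> D_in f H1 D x /\ D_in H1 H2 D x.

Definition m_index (a b c d eps : R) (n : nat) : Z :=
  Int_part (INR n * eps / (c * d) - Rmax a b / c).

(* [m_index] is the maximum of the integers [k] satisfying both bounds. *)
Lemma m_indexP (a b c d eps : R) (n : nat) (k : Z) :
  0 < c -> 0 < d -> (0 < n)%nat ->
  ((k <= m_index a b c d eps n)%Z <->
   (c * IZR k + a) * (d / INR n) <= eps /\
   (c * IZR k + b) * (d / INR n) <= eps).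
Proof.
intros hc hd hn; apply lt_0_INR in hn.
assert (E : forall t, (c * IZR k + t) * (d / INR n) <= eps <->
                      IZR k <= INR n * eps / (c * d) - t / c).
{ intros t.
  assert (P : 0 < c * d / INR n)
    by (apply Rdiv_lt_0_compat; [apply Rmult_lt_0_compat|]; assumption).
  replace ((c * IZR k + t) * (d / INR n))
    with (c * d / INR n * (IZR k + t / c)) by (field; lra).
  replace eps with (c * d / INR n * (INR n * eps / (c * d))) at 1
    by (field; lra).
  split; intros L.
  - apply Rmult_le_reg_l in L; [lra | exact P].
  - apply Rmult_le_compat_l; lra. }
rewrite !E; unfold m_index.
set (q := INR n * eps / (c * d)).
destruct (base_Int_part (q - Rmax a b / c)) as [I1 I2].
assert (M : forall t, t <= Rmax a b -> t / c <= Rmax a b / c).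
{ intros t ht; apply Rmult_le_compat_r; [|exact ht].
  apply Rlt_le, Rinv_0_lt_compat, hc. }
pose proof (M a (Rmax_l a b)); pose proof (M b (Rmax_r a b)).
split.
- intros L; apply IZR_le in L; lra.
- intros [La Lb].
  assert (L : IZR k <= q - Rmax a b / c)
    by (unfold Rmax; destruct (Rle_dec a b); assumption).
  apply Z.lt_succ_r, lt_IZR; rewrite succ_IZR; lra.
Qed.

(* For the finitely many [n] with [m_index < 0], where the product is not
   defined, [Z.to_nat] gives a junk value. *)
Definition D_prod (a b c d eps : R) (h : R -> R) (n : nat) : R :=
  prod_f_R0
    (fun j => h ((c * INR j + a) * (d / INR n))
              / h ((c * INR j + b) * (d / INR n)))
    (Z.to_nat (m_index a b c d eps n)).

Definition asymp_equiv (f g : nat -> R) : Prop :=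
  is_lim_seq (fun n => f n / g n) 1.

(* Main.v *)
(** Writing h(x) = x H(x), the product splits into
    prod (cj+a)/(cj+b) and prod H(x_j)/H(y_j).  With s = (a-b)/c, the logarithm
    of the first is s ln m + const + o(1), since comparing its terms with
    s ln((j+2)/(j+1)) leaves a summable O(1/j^2).  The logarithm of the second is
    s (ln H(eps) - ln H(0)) + o(1): by the mean value theorem and the uniform
    continuity of (ln H)', each ln H(x_j) - ln H(y_j) is s times the increment
    of ln H over a step of length cd/n, up to o(1/n), and these increments
    telescope.  Finally m/n -> eps/(cd). *)

Require Import Defs.
From Stdlib Require Import Reals ZArith Lra Lia.
From Coquelicot Require Import Coquelicot.
Open Scope R_scope.

(** * Logarithmic estimates and the product of the ratios (cj+a)/(cj+b) *)

Lemma ln_le_sub1 (x : R) : 0 < x -> ln x <= x - 1.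
Proof.
intros hx; pose proof (exp_ineq1_le (ln x)); rewrite exp_ln in *; lra.
Qed.

(** The inequality ln x <= x - 1, applied to (N+t)/N and to its inverse, traps the logarithm between
    t/(N+t) and t/N. The gap is t^2/(N(N+t)), and N >= 1 turns 1/(N+t) into a multiple of 1/N. *)
Lemma ln_one_plus_div_bound (t N : R) : -1 < t -> 1 <= N ->
  Rabs (ln ((N + t) / N) - t / N) <= t ^ 2 * (1 + / (1 + t)) * / N ^ 2.
Proof.
intros ht hN.
assert (up : ln ((N + t) / N) <= t / N).
{ replace (t / N) with ((N + t) / N - 1) by (field; lra).
  apply ln_le_sub1, Rdiv_lt_0_compat; lra. }
assert (lo : t / (N + t) <= ln ((N + t) / N)).
{ pose proof (ln_le_sub1 (N / (N + t))
    ltac:(apply Rdiv_lt_0_compat; lra)) as L.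
  rewrite <- (Ropp_involutive (ln _)), <- ln_Rinv
    by (apply Rdiv_lt_0_compat; lra).
  replace (/ ((N + t) / N)) with (N / (N + t)) by (field; lra).
  replace (t / (N + t)) with (- (N / (N + t) - 1)) by (field; lra).
  lra. }
rewrite Rabs_left1 by lra.
apply Rle_trans with (t / N - t / (N + t)); [lra|].
replace (t / N - t / (N + t)) with (t ^ 2 * / (N + t) * / N) by (field; lra).
replace (t ^ 2 * (1 + / (1 + t)) * / N ^ 2)
  with (t ^ 2 * ((1 + / (1 + t)) * / N) * / N) by (field; lra).
apply Rmult_le_compat_r; [apply Rlt_le, Rinv_0_lt_compat; lra|].
apply Rmult_le_compat_l; [apply pow2_ge_0|].
assert (E : (1 + / (1 + t)) * / N - / (N + t)
            = (t * (1 + t) + N + t) * / (N * (N + t) * (1 + t)))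
  by (field; lra).
enough (0 <= (t * (1 + t) + N + t) * / (N * (N + t) * (1 + t))) by lra.
apply Rmult_le_pos; [nra|].
apply Rlt_le, Rinv_0_lt_compat; repeat apply Rmult_lt_0_compat; lra.
Qed.

(** Comparison with a telescoping series of sum 2; the two terms differ by j/((j+1)^2 (j+2)) >=
    0. *)
Lemma ex_series_inv_square : ex_series (fun j => / (INR j + 1) ^ 2).
Proof.
apply (ex_series_le (K := R_AbsRing) (V := R_CompleteNormedModule))
  with (fun j => 2 * (/ (INR j + 1) - / (INR j + 2))).
- intros j; pose proof (pos_INR j).
  change (Rabs (/ (INR j + 1) ^ 2) <= 2 * (/ (INR j + 1) - / (INR j + 2))).
  rewrite Rabs_pos_eq by (apply Rlt_le, Rinv_0_lt_compat, pow_lt; lra).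
  enough (0 <= 2 * (/ (INR j + 1) - / (INR j + 2)) - / (INR j + 1) ^ 2) by lra.
  replace (_ - / (INR j + 1) ^ 2)
    with (INR j * / ((INR j + 1) ^ 2 * (INR j + 2))) by (field; lra).
  apply Rmult_le_pos; [lra|].
  apply Rlt_le, Rinv_0_lt_compat, Rmult_lt_0_compat; [apply pow_lt|]; lra.
- exists (2 * (1 - 0)).
  change (is_lim_seq (sum_n (fun j => 2 * (/ (INR j + 1) - / (INR j + 2))))
            (2 * (1 - 0))).
  apply (is_lim_seq_ext (fun n => 2 * (1 - / (INR n + 2)))).
  + intros n; rewrite sum_n_Reals; induction n as [|n IH].
    * simpl; field.
    * cbn [sum_f_R0]; rewrite <- IH, S_INR; pose proof (pos_INR n); field; lra.
  + apply (is_lim_seq_scal_l (fun n => 1 - / (INR n + 2)) 2 (1 - 0)), is_lim_seq_minus';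
      [apply is_lim_seq_const|].
    apply (is_lim_seq_inv _ p_infty); [|discriminate].
    apply is_lim_seq_plus with p_infty 2;
      [apply is_lim_seq_INR | apply is_lim_seq_const | reflexivity].
Qed.

Lemma ln_ratio_sum_lim (a b c : R) : 0 < a -> 0 < b -> 0 < c ->
  exists T : R, is_lim_seq (fun m =>
    sum_f_R0 (fun j => ln ((c * INR j + a) / (c * INR j + b))) m
    - (a - b) / c * ln (INR m + 2)) T.
Proof.
intros ha hb hc; set (s := (a - b) / c).
set (t := fun j => ln ((c * INR j + a) / (c * INR j + b))
                   - s * ln ((INR j + 1 + 1) / (INR j + 1))).
set (K := fun x => x ^ 2 * (1 + / (1 + x))).
assert (shift : forall x, 0 < x -> -1 < x / c - 1).
{ intros x hx; pose proof (Rdiv_lt_0_compat x c hx hc); lra. }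
assert (S : ex_series t).
{ apply (ex_series_le (K := R_AbsRing) (V := R_CompleteNormedModule)) with
    (fun j => (K (a / c - 1) + K (b / c - 1) + Rabs s * K 1)
              * / (INR j + 1) ^ 2).
  2:{ apply (ex_series_scal (K := R_AbsRing) (V := R_NormedModule) _
         (fun j => / (INR j + 1) ^ 2)), ex_series_inv_square. }
  intros j; change (Rabs (t j) <= (K (a / c - 1) + K (b / c - 1) + Rabs s * K 1)
              * / (INR j + 1) ^ 2).
  pose proof (pos_INR j) as hj; set (N := INR j + 1).
  assert (hN : 1 <= N) by (unfold N; lra).
  pose proof (ln_one_plus_div_bound _ N (shift a ha) hN) as Ba.
  pose proof (ln_one_plus_div_bound _ N (shift b hb) hN) as Bb.
  pose proof (ln_one_plus_div_bound 1 N ltac:(lra) hN) as B1.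
  assert (pos : forall x, 0 < x -> 0 < (N + (x / c - 1)) / N).
  { intros x hx; specialize (shift x hx); apply Rdiv_lt_0_compat; lra. }
  (* With N = j+1, (cj+a)/c = N + (a/c - 1), and likewise for b. The terms of order 1/N cancel since
     (a/c - 1) - (b/c - 1) = s, so only three errors of order 1/N^2 remain. *)
  assert (E : t j = (ln ((N + (a / c - 1)) / N) - (a / c - 1) / N)
                    - (ln ((N + (b / c - 1)) / N) - (b / c - 1) / N)
                    - s * (ln ((N + 1) / N) - 1 / N)).
  { unfold t; fold N.
    replace ((c * INR j + a) / (c * INR j + b))
      with ((N + (a / c - 1)) / N / ((N + (b / c - 1)) / N)).
    - rewrite ln_div by auto; unfold s; field; lra.
    - unfold N; assert (0 <= c * INR j) by (apply Rmult_le_pos; lra).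
      field; repeat split; try lra. }
  assert (tri : forall x y z, Rabs (x - y - z) <= Rabs x + Rabs y + Rabs z).
  { intros x y z; unfold Rabs; repeat destruct (Rcase_abs _); lra. }
  rewrite E; eapply Rle_trans; [apply tri|]; rewrite Rabs_mult.
  apply (Rmult_le_compat_l (Rabs s)) in B1; [|apply Rabs_pos].
  unfold K; lra. }
destruct S as [T hT]; exists T.
apply is_lim_seq_ext with (2 := hT).
intros m; rewrite sum_n_Reals; induction m as [|m IH].
- unfold t; simpl; rewrite Rplus_0_l.
  replace ((1 + 1) / 1) with (0 + 2) by field; ring.
- cbn [sum_f_R0]; rewrite IH; unfold t at 1; rewrite S_INR.
  pose proof (pos_INR m).
  rewrite (ln_div (INR m + 1 + 1 + 1)) by lra.
  replace (INR m + 1 + 1 + 1) with (INR m + 1 + 2) by ring.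
  replace (INR m + 1 + 1) with (INR m + 2) by ring; ring.
Qed.

(** * Riemann-type limit for sums of increments between shifted points *)

(* The points c j delta are compared from j = 0 but the first term of the sum is
   estimated separately, so that no point beyond M, where f may be uncontrolled,
   is needed. *)
Lemma shifted_sum_lim (f g : R -> R) (eps a b c : R)
  (delta : nat -> R) (M : nat -> nat) :
  0 < a -> 0 < b -> 0 < c ->
  (forall x, 0 <= x <= eps -> continuity_pt f x) ->
  (forall x, 0 <= x <= eps -> continuity_pt g x) ->
  (forall x, 0 < x < eps -> is_derive f x (g x)) ->
  eventually (fun n => 0 < delta n /\ (c * INR (M n) + a) * delta n <= eps /\
                       (c * INR (M n) + b) * delta n <= eps) ->
  is_lim_seq delta 0 ->
  is_lim_seq (fun n => c * INR (M n) * delta n) eps ->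
  is_lim_seq (fun n => sum_f_R0
      (fun j => f ((c * INR j + a) * delta n) - f ((c * INR j + b) * delta n))
      (M n))
    ((a - b) / c * (f eps - f 0)).
Proof.
intros ha hb hc cf cg df ev ld lp.
set (s := (a - b) / c).
(* No order between p and q is assumed, as a may be smaller or larger than b. *)
assert (mvt : forall p q, 0 <= p <= eps -> 0 <= q <= eps ->
  exists z, Rmin q p <= z <= Rmax q p /\ f p - f q = g z * (p - q)).
{ intros p q hp hq; apply MVT_gen; intros x.
  - unfold Rmin, Rmax; destruct (Rle_dec q p); intros; apply df; lra.
  - unfold Rmin, Rmax; destruct (Rle_dec q p); intros; apply cf; lra. }
assert (heps : 0 < eps).
{ destruct ev as [n0 h]; destruct (h n0 (Nat.le_refl _)) as (h1 & h2 & _).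
  eapply Rlt_le_trans; [|exact h2].
  apply Rmult_lt_0_compat; [|exact h1].
  pose proof (pos_INR (M n0)); pose proof (Rmult_le_pos c (INR (M n0))); lra. }
assert (lin0 : forall k, is_lim_seq (fun n => f (k * delta n)) (f 0)).
{ intros k; apply is_lim_seq_continuous; [apply cf; lra|].
  replace 0 with (k * 0) by ring.
  apply (is_lim_seq_scal_l delta k 0), ld. }
set (S := fun n k => sum_f_R0
  (fun j => f ((c * INR j + a) * delta n) - f ((c * INR j + b) * delta n)) k).
assert (main : is_lim_seq
   (fun n => S n (M n) - s * (f (c * INR (M n) * delta n) - f 0)) 0).
{ apply is_lim_seq_spec; intros e; cbn.
  (* [A] bounds the sum of the lengths |a - b| delta, because [M n] times delta is at most eps/c.
     Dividing by A + 1 below keeps the tolerance meaningful when a = b. *)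
  set (A := Rabs (a - b) * eps / c).
  assert (hA : 0 <= A).
  { unfold A; apply Rmult_le_pos; [apply Rmult_le_pos; [apply Rabs_pos|lra]|].
    apply Rlt_le, Rinv_0_lt_compat, hc. }
  assert (he : 0 < e / 2 / (A + 1)) by
    (pose proof (cond_pos e); apply Rdiv_lt_0_compat; lra).
  destruct (Heine g _ (compact_P3 0 eps) cg (mkposreal _ he)) as [eta U].
  cbn in U.
  assert (E1 : eventually (fun n => Rabs (f (a * delta n) - f (b * delta n) - 0) < e / 2)).
  { assert (L : is_lim_seq (fun n => f (a * delta n) - f (b * delta n)) (f 0 - f 0))
      by (apply is_lim_seq_minus'; apply lin0).
    replace (f 0 - f 0) with 0 in L by ring.
    apply is_lim_seq_spec in L.
    apply (L (mkposreal (e / 2) ltac:(pose proof (cond_pos e); lra))). }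
  (* (a + b + c) delta bounds the distance between the two mean value points compared in the
     induction. *)
  assert (E2 : eventually (fun n => Rabs ((a + b + c) * delta n - 0) < eta)).
  { assert (L : is_lim_seq (fun n => (a + b + c) * delta n) ((a + b + c) * 0))
      by apply (is_lim_seq_scal_l delta (a + b + c) 0), ld.
    rewrite Rmult_0_r in L; apply is_lim_seq_spec in L; apply (L eta). }
  generalize (filter_and _ _ ev (filter_and _ _ E1 E2)); apply filter_imp.
  intros n [(hd & hMa & hMb) [h1 h2]]; rewrite Rminus_0_r in *.
  set (d := delta n) in *.
  rewrite Rabs_pos_eq in h2 by (apply Rmult_le_pos; lra).
  (* The term of index k+1 is paired with the increment of f from ck delta to c(k+1) delta; the term
     of index 0 has no partner and stays as the first summand of the bound. *)
  assert (ind : forall k, (k <= M n)%nat ->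
    Rabs (S n k - s * (f (c * INR k * d) - f 0)) <=
    Rabs (f (a * d) - f (b * d)) + INR k * (e / 2 / (A + 1) * (Rabs (a - b) * d))).
  { induction k as [|k IH]; intros hk.
    - unfold S; cbn [sum_f_R0 INR]; fold d; rewrite !Rmult_0_r, !Rmult_0_l, !Rplus_0_l.
      rewrite Rminus_diag, Rmult_0_r, Rminus_0_r; lra.
    - specialize (IH ltac:(lia)).
      apply le_INR in hk; rewrite S_INR in hk.
      pose proof (pos_INR k) as k0.
      set (x := (c * INR (Datatypes.S k) + a) * d).
      set (y := (c * INR (Datatypes.S k) + b) * d).
      set (p := c * INR (Datatypes.S k) * d).
      set (q := c * INR k * d).
      assert (ck : c * (INR k + 1) <= c * INR (M n))
        by (apply Rmult_le_compat_l; lra).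
      assert (Hq : 0 <= q) by (unfold q; repeat apply Rmult_le_pos; lra).
      assert (Hp : p = q + c * d) by (unfold p, q; rewrite S_INR; ring).
      assert (Hx : x = p + a * d) by (unfold x, p; ring).
      assert (Hy : y = p + b * d) by (unfold y, p; ring).
      assert (x <= eps).
      { eapply Rle_trans; [|exact hMa]; apply Rmult_le_compat_r; [lra|].
        rewrite S_INR; lra. }
      assert (y <= eps).
      { eapply Rle_trans; [|exact hMb]; apply Rmult_le_compat_r; [lra|].
        rewrite S_INR; lra. }
      assert (0 < a * d) by (apply Rmult_lt_0_compat; lra).
      assert (0 < b * d) by (apply Rmult_lt_0_compat; lra).
      assert (0 < c * d) by (apply Rmult_lt_0_compat; lra).
      destruct (mvt x y ltac:(lra) ltac:(lra)) as (z & hz & Ez).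
      destruct (mvt p q ltac:(lra) ltac:(lra)) as (w & hw & Ew).
      (* Since w lies in [q, p], this gives 0 <= z - w <= (a + b + c) d, whichever of x and y is
         larger. *)
      assert (Zb : p <= z <= p + a * d + b * d).
      { unfold Rmin, Rmax in hz; destruct (Rle_dec y x); lra. }
      assert (Zs : z <= eps).
      { unfold Rmin, Rmax in hz; destruct (Rle_dec y x); lra. }
      rewrite Rmin_left, Rmax_right in hw by lra.
      assert (G : Rabs (g z - g w) <= e / 2 / (A + 1)).
      { apply Rlt_le, U; [lra|lra|]; rewrite Rabs_pos_eq by lra; lra. }
      (* Because s (p - q) = s c d = (a - b) d, both mean value expressions carry the same factor
         and only g z - g w survives. *)
      assert (step : S n (Datatypes.S k) - s * (f p - f 0) =
        (S n k - s * (f q - f 0)) + (g z - g w) * ((a - b) * d)).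
      { change (S n (Datatypes.S k)) with (S n k + (f x - f y)).
        replace (f p) with (f q + g w * (p - q)) by lra.
        rewrite Ez, Hx, Hy, Hp; unfold s; field; lra. }
      rewrite step; eapply Rle_trans; [apply Rabs_triang|].
      rewrite !Rabs_mult, (Rabs_pos_eq d) by lra.
      apply (Rmult_le_compat_r (Rabs (a - b) * d)) in G;
        [|apply Rmult_le_pos; [apply Rabs_pos|lra]].
      fold q in IH; rewrite S_INR; lra. }
  eapply Rle_lt_trans; [apply (ind _ (Nat.le_refl _))|].
  enough (INR (M n) * (e / 2 / (A + 1) * (Rabs (a - b) * d)) <= e / 2) by lra.
  assert (hM : INR (M n) * d <= eps / c).
  { apply Rmult_le_reg_l with c; [exact hc|].
    replace (c * (eps / c)) with eps by (field; lra).
    pose proof (Rmult_lt_0_compat a d ha hd); lra. }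
  apply (Rmult_le_compat_l (Rabs (a - b))) in hM; [|apply Rabs_pos].
  replace (INR (M n) * (e / 2 / (A + 1) * (Rabs (a - b) * d)))
    with (e / 2 / (A + 1) * (Rabs (a - b) * (INR (M n) * d))) by ring.
  apply Rle_trans with (e / 2 / (A + 1) * A).
  - apply Rmult_le_compat_l; [lra|]; unfold A; lra.
  - replace (e / 2) with (e / 2 / (A + 1) * (A + 1)) at 2 by (field; lra).
    apply Rmult_le_compat_l; lra. }
assert (L : is_lim_seq (fun n => s * (f (c * INR (M n) * delta n) - f 0))
              (s * (f eps - f 0))).
{ apply (is_lim_seq_scal_l _ s (f eps - f 0)), is_lim_seq_minus';
    [|apply is_lim_seq_const].
  apply is_lim_seq_continuous; [apply cf; lra | exact lp]. }
pose proof (is_lim_seq_plus' _ _ _ _ main L) as P; rewrite Rplus_0_l in P.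
apply is_lim_seq_ext with (2 := P); intros n; unfold S; ring.
Qed.

(** * Extension from the segment to the whole line *)

(* Precomposing with [clamp] turns the one-sided regularity on [0, eps] into
   two-sided regularity, as the library's mean value theorem requires. *)
Definition clamp (eps x : R) : R := Rmax 0 (Rmin x eps).

Lemma clamp_segment (eps x : R) : 0 < eps -> segment 0 eps (clamp eps x).
Proof.
unfold clamp, segment, Rmax, Rmin; destruct (Rle_dec x eps), (Rle_dec 0 _); lra.
Qed.

Lemma clamp_id (eps x : R) : segment 0 eps x -> clamp eps x = x.
Proof.
unfold clamp, segment, Rmax, Rmin; destruct (Rle_dec x eps), (Rle_dec 0 _); lra.
Qed.

Lemma clamp_dist (eps x y : R) : 0 < eps ->
  Rabs (clamp eps x - clamp eps y) <= Rabs (x - y).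
Proof.
unfold clamp, Rmax, Rmin; intros heps.
repeat destruct (Rle_dec _ _); unfold Rabs; repeat destruct (Rcase_abs _); lra.
Qed.

Lemma continuity_pt_clamp (f : R -> R) (eps : R) : 0 < eps ->
  (forall x, segment 0 eps x -> continue_in f (segment 0 eps) x) ->
  forall x, continuity_pt (fun y => f (clamp eps y)) x.
Proof.
intros heps cf x e he.
destruct (cf _ (clamp_segment eps x heps) e he) as (r & hr & H).
exists r; split; [exact hr|]; intros y [_ hy]; cbn in *; unfold Rdist in *.
(* Relative continuity speaks only of points other than the base point, yet distinct points can be
   clamped to the same one. *)
destruct (Req_dec (clamp eps y) (clamp eps x)) as [->|ne].
- rewrite Rminus_diag, Rabs_R0; exact he.
- apply H; split; [split; [apply clamp_segment, heps | lra]|].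
  eapply Rle_lt_trans; [apply clamp_dist, heps | exact hy].
Qed.

Lemma is_derive_clamp (f f1 : R -> R) (eps x : R) : 0 < x < eps ->
  D_in f f1 (segment 0 eps) x ->
  is_derive (fun y => f (clamp eps y)) x (f1 (clamp eps x)).
Proof.
intros hx D; rewrite (clamp_id eps x) by (unfold segment; lra).
apply is_derive_Reals; intros e he.
destruct (D e he) as (r & hr & H).
(* This radius keeps x + u inside the segment, where [clamp] is the identity. *)
assert (hm : 0 < Rmin r (Rmin x (eps - x))) by (repeat apply Rmin_glb_lt; lra).
exists (mkposreal _ hm); intros u hu0 hu; cbn in hu.
assert (u1 : Rabs u < r) by (eapply Rlt_le_trans; [exact hu|apply Rmin_l]).
assert (u2 : Rabs u < x) by (eapply Rlt_le_trans; [exact hu|];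
  eapply Rle_trans; [apply Rmin_r|apply Rmin_l]).
assert (u3 : Rabs u < eps - x) by (eapply Rlt_le_trans; [exact hu|];
  eapply Rle_trans; [apply Rmin_r|apply Rmin_r]).
apply Rabs_def2 in u2, u3.
specialize (H (x + u)); cbn in H; unfold Rdist in H.
replace (x + u - x) with u in H by ring.
rewrite !clamp_id by (unfold segment; lra).
apply H; repeat split; unfold segment; lra.
Qed.

(** * Products as exponentials of sums, and the growth of the index *)

Lemma prod_f_R0_exp (F : nat -> R) (N : nat) :
  prod_f_R0 (fun j => exp (F j)) N = exp (sum_f_R0 F N).
Proof.
induction N as [|N IH]; cbn; [reflexivity|]; rewrite IH, exp_plus; reflexivity.
Qed.

Lemma prod_f_R0_ext (F G : nat -> R) (N : nat) :
  (forall j, (j <= N)%nat -> F j = G j) -> prod_f_R0 F N = prod_f_R0 G N.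
Proof.
induction N as [|N IH]; intros E; cbn; [apply E; lia|].
rewrite IH by (intros; apply E; lia); rewrite E by lia; reflexivity.
Qed.

Lemma INR_m_index_bounds (a b c d eps : R) : 0 < c -> 0 < d -> 0 < eps ->
  eventually (fun n => (0 < n)%nat /\
    let M := Z.to_nat (m_index a b c d eps n) in
    INR M = IZR (m_index a b c d eps n) /\
    INR n * eps / (c * d) - Rmax a b / c - 1 <= INR M
      <= INR n * eps / (c * d) - Rmax a b / c).
Proof.
intros hc hd heps.
assert (hk : 0 < eps / (c * d))
  by (apply Rdiv_lt_0_compat; [|apply Rmult_lt_0_compat]; assumption).
(* From this rank on the floor exceeds -1, hence is nonnegative, and [Z.to_nat] loses nothing. *)
destruct (INR_archimed (eps / (c * d)) (Rmax a b / c + 1) hk) as [n0 h0].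
exists (S n0); intros n hn; split; [lia|].
destruct (base_Int_part (INR n * eps / (c * d) - Rmax a b / c)) as [I1 I2].
fold (m_index a b c d eps n) in I1, I2.
apply le_INR in hn; rewrite S_INR in hn.
assert (Hn : INR n0 * (eps / (c * d)) <= INR n * (eps / (c * d)))
  by (apply Rmult_le_compat_r; lra).
assert (E : INR n * eps / (c * d) = INR n * (eps / (c * d)))
  by (unfold Rdiv; ring).
assert (P : (-1 < m_index a b c d eps n)%Z) by (apply lt_IZR; lra).
assert (EM : INR (Z.to_nat (m_index a b c d eps n)) = IZR (m_index a b c d eps n))
  by (rewrite INR_IZR_INZ, Z2Nat.id by lia; reflexivity).
cbv zeta; rewrite EM; split; [reflexivity|lra].
Qed.

(** * Assembly of the asymptotics *)

Theorem theorem2 (a b c d : R) (ha : 0 < a) (hb : 0 < b) (hc : 0 < c) (hd : 0 < d)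
  (h : R -> R) (hS : S_function h)
  (eps : R) (heps : 0 < eps) (hcomp : compatible c d eps)
  (H1 H2 : R -> R)
  (hder : twice_derivative_on (segment 0 eps) (H_of h) H1 H2)
  (hpos : forall x : R, segment 0 eps x -> 0 < H_of h x)
  (hconc : forall x : R, segment 0 eps x -> H2 x <= 0) :
  exists C : R, 0 < C /\
    asymp_equiv (D_prod a b c d eps h)
                (fun n => C * Rpower (INR n) ((a - b) / c)).
Proof.
set (s := (a - b) / c); set (k := eps / (c * d)).
set (H := H_of h) in *.
set (f := fun x => ln (H (clamp eps x))).
set (g := fun x => H1 (clamp eps x) / H (clamp eps x)).
set (M := fun n => Z.to_nat (m_index a b c d eps n)).
assert (hcd : 0 < c * d) by (apply Rmult_lt_0_compat; assumption).
assert (hk : 0 < k) by (apply Rdiv_lt_0_compat; assumption).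
assert (Hpos : forall x, 0 < H (clamp eps x))
  by (intros x; apply hpos, clamp_segment, heps).
assert (cH : forall x, continuity_pt (fun y => H (clamp eps y)) x).
{ apply continuity_pt_clamp; [exact heps|]; intros x hx.
  exact (cont_deriv _ _ _ _ (proj1 (hder x hx))). }
(* [H1] is continuous because it has the derivative [H2] relative to the segment; hence so is g, the
   logarithmic derivative of H. *)
assert (cH1 : forall x, continuity_pt (fun y => H1 (clamp eps y)) x).
{ apply continuity_pt_clamp; [exact heps|]; intros x hx.
  exact (cont_deriv _ _ _ _ (proj2 (hder x hx))). }
assert (cln : forall x, 0 < x -> continuity_pt ln x).
{ intros x hx; apply derivable_continuous_pt.
  exists (/ x); apply derivable_pt_lim_ln, hx. }
assert (cf : forall x, continuity_pt f x).
{ intros x; apply (continuity_pt_comp (fun y => H (clamp eps y)) ln);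
    [apply cH | apply cln, Hpos]. }
assert (cg : forall x, continuity_pt g x).
{ intros x; apply (continuity_pt_div (fun y => H1 (clamp eps y))
                                     (fun y => H (clamp eps y)));
    [apply cH1 | apply cH | apply Rgt_not_eq, Hpos]. }
assert (df : forall x, 0 < x < eps -> is_derive f x (g x)).
{ intros x hx; apply (is_derive_comp ln (fun y => H (clamp eps y))).
  - apply is_derive_Reals, derivable_pt_lim_ln, Hpos.
  - apply is_derive_clamp; [exact hx|].
    apply (hder x); unfold segment; lra. }
pose proof (INR_m_index_bounds a b c d eps hc hd heps) as ev.
assert (pts : eventually (fun n => 0 < d / INR n /\
    (c * INR (M n) + a) * (d / INR n) <= eps /\
    (c * INR (M n) + b) * (d / INR n) <= eps)).
{ generalize ev; apply filter_imp; intros n (hn & EM & _).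
  split; [apply Rdiv_lt_0_compat; [exact hd | apply lt_0_INR, hn]|].
  unfold M; rewrite EM; apply m_indexP; auto; lia. }
assert (inv0 : forall x, is_lim_seq (fun n => x * / INR n) 0).
{ intros x; replace 0 with (x * 0) by ring.
  apply (is_lim_seq_scal_l (fun n => / INR n) x 0).
  apply (is_lim_seq_inv _ p_infty); [apply is_lim_seq_INR | discriminate]. }
(* Squeeze between the two floor bounds divided by n. *)
assert (Mn : is_lim_seq (fun n => INR (M n) * / INR n) k).
{ assert (L : forall x, is_lim_seq (fun n => k - x * / INR n) k).
  { intros x; replace k with (k - 0) at 1 by ring.
    apply is_lim_seq_minus'; [apply is_lim_seq_const | apply inv0]. }
  apply (is_lim_seq_le_le_loc (fun n => k - (Rmax a b / c + 1) * / INR n) _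
                              (fun n => k - Rmax a b / c * / INR n));
    [|apply L|apply L].
  generalize ev; apply filter_imp; intros n (hn & _ & l1 & l2); fold (M n) in l1, l2.
  apply lt_0_INR in hn.
  assert (hi : 0 < / INR n) by (apply Rinv_0_lt_compat, hn).
  apply (Rmult_le_compat_r (/ INR n)) in l1; [|lra].
  apply (Rmult_le_compat_r (/ INR n)) in l2; [|lra].
  assert (E : INR n * eps / (c * d) * / INR n = k)
    by (unfold k; field; lra).
  lra. }
assert (Minf : filterlim M eventually eventually).
{ intros P [N hN]; change (eventually (fun n => P (M n))).
  destruct (INR_archimed k (INR N + Rmax a b / c + 1) hk) as [n0 h0].
  assert (ev0 : eventually (fun n => (n0 <= n)%nat)) by (exists n0; auto).
  generalize (filter_and _ _ ev ev0); apply filter_imp.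
  intros n [(_ & _ & l1 & _) hn]; fold (M n) in l1; apply hN, INR_le.
  apply le_INR, (Rmult_le_compat_r k) in hn; [|lra].
  replace (INR n * eps / (c * d)) with (INR n * k) in l1
    by (unfold k; field; lra).
  lra. }
destruct (ln_ratio_sum_lim a b c ha hb hc) as [T hT].
apply (is_lim_seq_subseq _ _ _ Minf) in hT; fold s in hT.
assert (hF : is_lim_seq (fun n => sum_f_R0 (fun j =>
    f ((c * INR j + a) * (d / INR n)) - f ((c * INR j + b) * (d / INR n))) (M n))
    (s * (f eps - f 0))).
{ apply (shifted_sum_lim f g eps a b c (fun n => d / INR n) M); auto.
  - apply inv0.
  - replace eps with (c * d * k) by (unfold k; field; lra).
    apply is_lim_seq_ext with (fun n => c * d * (INR (M n) * / INR n));
      [intros n; unfold Rdiv; ring|].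
    apply (is_lim_seq_scal_l _ (c * d) k), Mn. }
(* The argument is (M n + 2)/n, so this trades s ln(M n + 2) for s ln n at the cost of the constant
   s ln k. *)
assert (hL : is_lim_seq (fun n => s * ln (INR (M n) * / INR n + 2 * / INR n))
               (s * ln k)).
{ apply (is_lim_seq_scal_l _ s (ln k)), is_lim_seq_continuous;
    [apply cln, hk|].
  replace k with (k + 0) by ring; apply is_lim_seq_plus'; [exact Mn | apply inv0]. }
(* ln C collects the limit for the ratios, the limit for ln H, and the passage from M n to n. *)
set (c0 := T + s * (f eps - f 0) + s * ln k).
exists (exp c0); split; [apply exp_pos|]; unfold asymp_equiv.
pose proof (is_lim_seq_minus' _ _ _ _
  (is_lim_seq_plus' _ _ _ _ (is_lim_seq_plus' _ _ _ _ hT hF) hL)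
  (is_lim_seq_const c0)) as X; fold c0 in X; rewrite Rminus_diag in X.
apply (is_lim_seq_continuous exp) in X;
  [|apply derivable_continuous_pt, derivable_pt_exp].
rewrite exp_0 in X.
(* It remains to see that, for large n, the quotient of the two sides is exactly the exponential of
   the sequence in [X]. *)
apply is_lim_seq_ext_loc with (2 := X).
generalize (filter_and _ _ ev pts); apply filter_imp.
intros n [(hn & _ & _) (hdn & pa & pb)]; cbv beta.
apply lt_0_INR in hn; pose proof (pos_INR (M n)) as hM.
unfold D_prod; fold (M n).
rewrite (prod_f_R0_ext _ (fun j => exp (ln ((c * INR j + a) / (c * INR j + b)) +
  (f ((c * INR j + a) * (d / INR n)) - f ((c * INR j + b) * (d / INR n)))))).
- rewrite prod_f_R0_exp, plus_sum; unfold Rpower; rewrite <- exp_plus.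
  unfold Rdiv at 4; rewrite <- exp_Ropp, <- exp_plus; f_equal; fold s.
  replace (INR (M n) * / INR n + 2 * / INR n) with ((INR (M n) + 2) / INR n)
    by (field; lra).
  rewrite (ln_div (INR (M n) + 2)) by lra; ring.
- intros j hj; apply le_INR in hj; pose proof (pos_INR j) as hj0.
  assert (cj : 0 <= c * INR j) by (apply Rmult_le_pos; lra).
  assert (cM : c * INR j <= c * INR (M n)) by (apply Rmult_le_compat_l; lra).
  (* The sample points lie in (0, eps], so [clamp] fixes them and [H_of] takes its branch h x /
     x. *)
  assert (val : forall t, 0 < t -> (c * INR (M n) + t) * (d / INR n) <= eps ->
    h ((c * INR j + t) * (d / INR n)) =
      (c * INR j + t) * (d / INR n) * exp (f ((c * INR j + t) * (d / INR n)))).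
  { intros t ht hle; unfold f; set (x := (c * INR j + t) * (d / INR n)).
    assert (hx : 0 < x) by (apply Rmult_lt_0_compat; lra).
    assert (hxe : x <= eps).
    { eapply Rle_trans; [|exact hle]; apply Rmult_le_compat_r; lra. }
    rewrite exp_ln by apply Hpos; rewrite clamp_id by (unfold segment; lra).
    unfold H, H_of; destruct (Req_EM_T x 0); [lra|]; field; lra. }
  rewrite (val a ha pa), (val b hb pb).
  unfold Rminus; rewrite !exp_plus, exp_Ropp, exp_ln
    by (apply Rdiv_lt_0_compat; lra).
  pose proof (exp_pos (f ((c * INR j + b) * (d / INR n)))).
  field; repeat split; lra.
Qed.
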